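(* Let $q=p^e$ with $p$ an odd prime and $e\ge3$ odd. Let $f\in\mathcal{RF}$ with $\varepsilon$ the sign of its Walsh transform. Let $\beta$ be a generator of $\mathbb{F}_q^*$, let $d_1,\dots,d_q$ be the elements of $\mathbb{F}_q$ with $d_q=0$, and let $G_2$ be the $(e+2)\times q$ matrix with first row $(1,\dots,1)$, second row $(f(d_1)+1,\dots,f(d_q)+1)$, and $(i+3)$-th row $(\mathrm{Tr}_{q/p}(\beta^id_1),\dots,\mathrm{Tr}_{q/p}(\beta^id_q))$ for $0\le i\le e-1$. Let $\mathcal{C}_f'$ be the $p$-ary code generated by $G_2'=[I_{e+2}:G_2]$. If $\varepsilon(\eta_0(-1))^{(e+1)/2}=1$, then $\mathcal{C}_f'$ has parameters $[p^e+e+2,\ e+2,\ p^e-p^{e-1}-p^{\frac{e-1}{2}}+1]$; if $\varepsilon(\eta_0(-1))^{(e+1)/2}=-1$, then $\mathcal{C}_f'$ has parameters $[p^e+e+2,\ e+2,\ p^e-p^{e-1}-p^{\frac{e-1}{2}}+2]$. Moreover, $\mathcal{C}_f'^{\perp}$ has parameters $[p^e+e+2,\ p^e,\ 3]$ and is at least almost optimal according to the sphere-packing bound.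
   Context: $\zeta_p=e^{2\pi i/p}$; $\mathrm{Tr}_{q/p}$ is the trace map from $\mathbb{F}_q$ to $\mathbb{F}_p$; $\eta_0$ is the quadratic character of $\mathbb{F}_p$; $p^*=(-1)^{(p-1)/2}p$ with $\sqrt{p^*}=\sqrt p$ if $p\equiv1\pmod 4$ and $\sqrt{-1}\sqrt p$ otherwise. Walsh transform of $f:\mathbb{F}_{p^e}\to\mathbb{F}_p$: $W_f(\beta)=\sum_x\zeta_p^{f(x)-\mathrm{Tr}_{p^e/p}(\beta x)}$; $f$ is weakly regular bent with sign $\varepsilon\in\{\pm1\}$ and dual $f^*:\mathbb{F}_{p^e}\to\mathbb{F}_p$ if $W_f(\beta)=\varepsilon\sqrt{p^*}^e\zeta_p^{f^*(\beta)}$ for all $\beta$. $\mathcal{RF}$ is the set of weakly regular bent $f$ with $f(0)=0$ and $f(ax)=a^hf(x)$ for all $a\in\mathbb{F}_p^*$, $x$, for some positive even $h$ with $\gcd(h-1,p-1)=1$. ''At least almost optimal according to the sphere-packing bound'' means the sphere-packing bound rules out a code with the same length and dimension and minimum distance $d+2$. *)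

(* Defs.v *)
From HB Require Import structures.
From mathcomp Require Import all_boot all_order all_algebra all_field.
Unset Printing Implicit Defensive.
Import Order.TTheory GRing.Theory Num.Theory.
Local Open Scope ring_scope.

(* The element of 'F_p corresponding to y in the prime subfield of F
   (0 if y is not in the prime subfield). *)
Definition toFp (p : nat) {F : finFieldType} (y : F) : 'F_p :=
  odflt 0 [pick k : 'F_p | ((k : nat)%:R : F) == y].

Definition ofFp (p : nat) {F : finFieldType} (a : 'F_p) : F := (a : nat)%:R.

Definition trace (p e : nat) {F : finFieldType} (x : F) : 'F_p :=
  toFp p (\sum_(i < e) x ^+ (p ^ i)).

(* zeta_p = e^{2 pi i/p}: p.-root (-1) is e^{i pi/p} (minimal argument). *)
Definition zeta (p : nat) : algC := (p.-root (-1)) ^+ 2.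

Definition sqrt_pstar (p : nat) : algC :=
  if (p %% 4 == 1)%N then sqrtC (p%:R) else 'i * sqrtC (p%:R).

Definition walsh (p e : nat) {F : finFieldType} (f : F -> 'F_p) (b : F) : algC :=
  \sum_(x : F) zeta p ^+ (nat_of_ord (f x - trace p e (b * x))).

Definition weakly_regular_bent (p e : nat) {F : finFieldType} (f : F -> 'F_p)
  (eps : int) (fstar : F -> 'F_p) : Prop :=
  (eps = 1 \/ eps = -1) /\
  forall b : F, walsh p e f b = eps%:~R * sqrt_pstar p ^+ e * zeta p ^+ (nat_of_ord (fstar b)).

Definition in_RF (p e : nat) {F : finFieldType} (f : F -> 'F_p) : Prop :=
  (exists (eps : int) (fstar : F -> 'F_p), weakly_regular_bent p e f eps fstar) /\
  f 0 = 0 /\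
  exists h : nat, [/\ (0 < h)%N, ~~ odd h, coprime h.-1 p.-1 &
    forall (a : 'F_p) (x : F), a != 0 -> f (ofFp p a * x) = a ^+ h * f x].

Definition eta0 (p : nat) (a : 'F_p) : int :=
  if a == 0 then 0 else if [exists y : 'F_p, y ^+ 2 == a] then 1 else -1.

Definition wt {K : fieldType} {n : nat} (v : 'rV[K]_n) : nat := #|[set j | v 0 j != 0]|.

Definition is_min_dist {K : fieldType} {m n : nat} (C : 'M[K]_(m, n)) (d : nat) : Prop :=
  (exists v : 'rV[K]_n, [/\ (v <= C)%MS, v != 0 & wt v = d]) /\
  (forall v : 'rV[K]_n, (v <= C)%MS -> v != 0 -> (d <= wt v)%N).

Definition code_params {K : fieldType} {m n : nat} (C : 'M[K]_(m, n)) (len k d : nat) : Prop :=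
  [/\ n = len, \rank C = k & is_min_dist C d].

Definition dual_code {K : fieldType} {m n : nat} (G : 'M[K]_(m, n)) : 'M[K]_n := kermx G^T.

Definition sphere_packing_excludes (q n k d : nat) : Prop :=
  (q ^ n < q ^ k * \sum_(i < ((d - 1)./2).+1) 'C(n, i) * (q - 1) ^ i)%N.

Definition G2 (p e : nat) {F : finFieldType} (f : F -> 'F_p) (beta : F)
  (d : 'I_(p ^ e) -> F) : 'M['F_p]_(e.+2, p ^ e) :=
  \matrix_(i < e.+2, j < p ^ e)
    if (i : nat) == 0%N then 1
    else if (i : nat) == 1%N then f (d j) + 1
    else trace p e (beta ^+ (i - 2) * d j).

Definition G2' (p e : nat) {F : finFieldType} (f : F -> 'F_p) (beta : F)
  (d : 'I_(p ^ e) -> F) : 'M['F_p]_(e.+2, e.+2 + p ^ e) :=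
  row_mx 1%:M (G2 p e f beta d).

(* Main.v *)
Require Import Defs.
From HB Require Import structures.
From mathcomp Require Import all_boot all_order all_algebra all_field.
From mathcomp Require Import cyclic ring zify.
Import Order.TTheory GRing.Theory Num.Theory.
Set Implicit Arguments.
Unset Strict Implicit.
Local Open Scope ring_scope.

(** The codeword of [u = (a, b, c_0, ..., c_(e-1))] is [u] followed by the values
    [b f(x) + Tr(g x) + a + b], where [g] is the sum of the [c_i beta^i].  For
    [b <> 0], the Walsh transform of [f] is an integer multiple of a translate of
    the quadratic Gauss sum, and the linear independence of the powers of [zeta]
    gives the number of zeros of this function:
    [p^(e-1) + E p^((e-1)/2) eta(t)], with [E = eps eta(-1)^((e+1)/2)] and
    [t = f*(-g/b) + 1 + a/b].  A parity argument shows [f*(0) = 0], so that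
    [t = 1] when [u] has weight one and [b <> 0]; this explains the two cases.

    The sign of the Gauss sum matters: [E] would change sign with it.  It is
    computed after Kronecker, by writing the sum as a signed product of
    differences [om^k - om^(-k)], where [om^2 = zeta], and reducing a polynomial
    identity modulo [p] at [X = 1].

    The dual code has distance 3 because the columns of the generator matrix are
    pairwise independent, and the column of [x = 0] is the sum of the first two
    unit vectors. *)

(** * Prime fields and the quadratic character *)

Section PrimeField.

Variable p : nat.
Hypothesis p_pr : prime p.

Lemma val_FpD (a b : 'F_p) : ((a + b)%R : nat) = ((a + b) %% p)%N.
Proof. by rewrite /=; congr (_ %% _)%N; apply: Fp_cast. Qed.

Lemma val_FpM (a b : 'F_p) : ((a * b)%R : nat) = ((a * b) %% p)%N.
Proof. by rewrite /=; congr (_ %% _)%N; apply: Fp_cast. Qed.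

Lemma expr_FpD (R : pzRingType) (z : R) (a b : 'F_p) :
  z ^+ p = 1 -> z ^+ (a + b)%R = z ^+ a * z ^+ b.
Proof. by move=> zp; rewrite val_FpD expr_mod // exprD. Qed.

Lemma finField_exp_pred (F : finFieldType) (x : F) :
  x != 0 -> x ^+ #|F|.-1 = 1.
Proof.
move=> x0; apply: (mulfI x0).
by rewrite -exprS prednK ?expf_card ?mulr1 // ltnW // finNzRing_gt1.
Qed.

Lemma finField_prim_root (F : finFieldType) :
  exists z : F, (#|F|.-1).-primitive_root z.
Proof.
have cF := finNzRing_gt1 F.
have /hasP[z _ pz] : has (#|F|.-1).-primitive_root (enum [pred x : F | x != 0]).
  apply: has_prim_root.
  - by rewrite -ltnS prednK // ltnW.
  - apply/allP => x; rewrite mem_enum inE => x0; apply/unity_rootP.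
    exact: finField_exp_pred.
  - exact: enum_uniq.
  - by rewrite -cardE cardC1.
by exists z.
Qed.

(** For positive [k], multiplication by a generator [z] permutes [F] and multiplies the sum by
    [z ^+ k], which is not 1. For [k = 0] the sum is the order of [F], a multiple of the
    characteristic. *)
Lemma sum_finField_exp (F : finFieldType) (k : nat) :
  (k < #|F|.-1)%N -> \sum_(x : F) x ^+ k = 0.
Proof.
case: k => [_|k ltk].
  under eq_bigr => x _ do rewrite expr0.
  have [q q_pr cq] := finPcharP F.
  rewrite sumr_const -[#|_|]/#|F|.
  have [n ->] : exists n, #|F| = (q * n)%N; last first.
    by rewrite -mulr_natr natrM pcharf0 // mul0r mulr0.
  exists (#|F| %/ q)%N; rewrite mulnC divnK //.
  have [n oF] : exists n, #|F| = (q ^ n)%N by eexists; exact: card_pprimeChar cq.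
  have := finNzRing_gt1 F; rewrite oF.
  by case: n {oF} => // n _; rewrite expnS dvdn_mulr.
have [z pz] := finField_prim_root F.
have z0 : z != 0 by rewrite (prim_root_eq0 pz) -lt0n (leq_trans _ ltk).
apply/eqP; have : (z ^+ k.+1 - 1) * \sum_(x : F) x ^+ k.+1 = 0.
  rewrite mulrBl mul1r big_distrr /= [X in _ - X](reindex_inj (mulfI z0)) /=.
  by rewrite -sumrB big1 // => x _; rewrite exprMn subrr.
move/eqP; rewrite mulf_eq0 subr_eq0 => /orP[|//].
by rewrite -(prim_order_dvd pz) gtnNdvd.
Qed.

Lemma sum_finField_exp_pred (F : finFieldType) :
  \sum_(x : F) x ^+ #|F|.-1 = -1.
Proof.
have cF := finNzRing_gt1 F.
have fx (x : F) : x ^+ #|F|.-1 = 1 - (x == 0)%:R.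
  have [->|x0] := eqVneq x 0.
    by rewrite subrr expr0n gtn_eqF // -ltnS prednK // ltnW.
  by rewrite finField_exp_pred ?subr0.
under eq_bigr => x _ do rewrite fx.
have s1 : \sum_(x : F) (1 : F) = 0.
  rewrite -[RHS](@sum_finField_exp F 0); last by rewrite -ltnS prednK // ltnW.
  by apply: eq_bigr => x _; rewrite expr0.
rewrite sumrB s1.
rewrite (bigD1 0) //= eqxx big1 ?addr0 ?sub0r // => x /negPf -> //.
Qed.

(** Only the exponent [#|F|.-1] has a nonzero power sum. In [gauss_sineprod] this turns a sum over
    ['F_p] into a leading coefficient. *)
Lemma sum_finField_horner (F : finFieldType) (P : {poly F}) :
  (size P <= #|F|)%N -> \sum_(x : F) P.[x] = - P`_(#|F|.-1).
Proof.
move=> sP; have cF := ltnW (finNzRing_gt1 F).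
under eq_bigr => x _ do rewrite (horner_coef_wide _ sP).
rewrite exchange_big /=; under eq_bigr => i _ do rewrite -big_distrr /=.
rewrite -(prednK cF) big_ord_recr /= sum_finField_exp_pred mulrN1 big1 ?add0r //.
by move=> i _; rewrite sum_finField_exp ?mulr0.
Qed.

Hypothesis p_odd : odd p.

Lemma Fp_N1_neq1 : (-1 : 'F_p) != 1.
Proof.
rewrite eq_sym -addr_eq0 -[1 + 1]/(2%:R) -(dvdn_pcharf (pchar_Fp p_pr)).
rewrite gtnNdvd //; have := prime_gt1 p_pr; case: p p_odd => [|[|[]]] //.
Qed.

Lemma half_pred_double : ((p.-1)./2 + (p.-1)./2)%N = p.-1.
Proof.
rewrite addnn -[RHS]odd_double_half.
by move: p_odd; case: (p) => //= n /negPf ->.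
Qed.

Lemma Fp_Euler (a : 'F_p) :
  a ^+ (p.-1)./2 = (eta0 p a)%:~R.
Proof.
have p1 := prime_gt1 p_pr; have p2 := half_pred_double.
have p3 := odd_prime_gt2 p_odd p_pr.
rewrite /eta0; have [->|a0] := eqVneq a 0.
  by rewrite expr0n; case: (p.-1)./2 p2 => //; lia.
have a1 (b : 'F_p) : b != 0 -> b ^+ p.-1 = 1.
  by move/finField_exp_pred; rewrite card_Fp.
case: existsP => [[y /eqP ya]|ny].
  rewrite -ya -exprM mul2n -addnn p2 a1 //.
  by apply: contraNneq a0 => y0; rewrite -ya y0 expr0n.
have : (a ^+ (p.-1)./2) ^+ 2 = 1 by rewrite -exprM muln2 -addnn p2 a1.
move/eqP; rewrite sqrf_eq1 => /orP[/eqP h|/eqP -> //].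
(* If [a = z ^+ i] had Euler power 1, then [p.-1] would divide [i * (p.-1)./2], so [i] would be even
   and [a] a square. *)
case: ny; have [z pz] := finField_prim_root 'F_p; rewrite card_Fp // in pz.
have [i ai] := prim_rootP pz (a1 _ a0).
have : (p.-1 %| i * (p.-1)./2)%N by rewrite (prim_order_dvd pz) exprM -ai h.
rewrite -{1}p2 addnn -mul2n dvdn_pmul2r; last by lia.
move=> /dvdnP[k ik]; exists (z ^+ k); by rewrite ai ik exprM.
Qed.

Lemma eta0_cases (a : 'F_p) : [\/ eta0 p a = 0, eta0 p a = 1 | eta0 p a = -1].
Proof.
rewrite /eta0; case: ifP => _; first by constructor 1.
by case: ifP => _; [constructor 2|constructor 3].
Qed.

Lemma eta0_eq0 (a : 'F_p) : eta0 p a = 0 -> a = 0.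
Proof. by rewrite /eta0; case: eqP => // _; case: ifP. Qed.

(** Two such integers differ by at most 2, which is less than [p]. Hence identities between values
    of [eta0] may be checked in ['F_p] through Euler's criterion. *)
Lemma Fp_sign_inj (u v : int) :
  `|u| <= 1 -> `|v| <= 1 -> u%:~R = v%:~R :> 'F_p -> u = v.
Proof.
move=> hu hv /eqP; rewrite -subr_eq0 -intrB => huv; apply/eqP.
have : (`|u - v| < 3)%N by lia.
have {huv} : (p %| `|u - v|)%N.
  rewrite (dvdn_pcharf (pchar_Fp p_pr)); move: huv; rewrite {1}[u - v]intEsign.
  by rewrite intrM mulf_eq0 rmorph_sign signr_eq0.
move=> /dvdnP[[|k] huv] h3; first by apply/eqP; lia.
have := odd_prime_gt2 p_odd p_pr; lia.
Qed.

Lemma eta0_norm (a : 'F_p) : `|eta0 p a| <= 1.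
Proof. by case: (eta0_cases a) => ->. Qed.

Lemma eta0N (a : 'F_p) : eta0 p (- a) = eta0 p (-1) * eta0 p a.
Proof.
apply: Fp_sign_inj; first exact: eta0_norm.
  by rewrite normrM mulr_ile1 ?eta0_norm.
by rewrite intrM -!Fp_Euler -exprMn mulN1r.
Qed.

Lemma eta0_N1 : eta0 p (-1) = (-1) ^+ (p.-1)./2.
Proof.
apply: Fp_sign_inj; rewrite ?eta0_norm ?normrX ?normrN1 ?expr1n //.
by rewrite -Fp_Euler rmorph_sign.
Qed.

Lemma eta0_1 : eta0 p 1 = 1.
Proof.
rewrite /eta0 oner_eq0; case: existsP => // -[].
by exists 1; rewrite expr1n.
Qed.

Lemma card_Fp_sqrt (s : 'F_p) :
  (#|[set x : 'F_p | x ^+ 2 == s]|)%:Z = 1 + eta0 p s.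
Proof.
rewrite /eta0; have [->|s0] := eqVneq s 0.
  rewrite addr0 (_ : [set _ | _] = [set 0]) ?cards1 //.
  by apply/setP => x; rewrite !inE expf_eq0.
case: existsP => [[y /eqP ys]|ny].
  have y0 : y != 0 by apply: contraNneq s0 => y0; rewrite -ys y0 expr0n.
  rewrite (_ : [set _ | _] = [set y; -y]) ?cards2; last first.
    by apply/setP => x; rewrite !inE -ys eqf_sqr.
  rewrite -subr_eq0 opprK -mulr2n -mulr_natr mulf_eq0 (negPf y0) /=.
  by rewrite -[2%:R]/(1+1) addr_eq0 eq_sym (negPf Fp_N1_neq1).
rewrite (_ : [set _ | _] = set0) ?cards0 ?subrr //.
by apply/setP => x; rewrite !inE; apply/negP => /eqP h; apply: ny; exists x; rewrite h.
Qed.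

(** Squaring takes the value [s] exactly [1 + eta0 p s] times. *)
Lemma sum_Fp_sqr (V : zmodType) (h : 'F_p -> V) :
  \sum_(x : 'F_p) h (x ^+ 2) = \sum_s h s + \sum_s h s *~ eta0 p s.
Proof.
rewrite (partition_big (fun x : 'F_p => x ^+ 2) predT) //= -big_split /=.
apply: eq_bigr => s _; rewrite (eq_bigr (fun=> h s)); last by move=> x /eqP ->.
rewrite sumr_const -[X in X + _]mulr1z -mulrzDr -card_Fp_sqrt -pmulrn.
by congr (_ *+ _); apply: eq_card => x; rewrite !inE.
Qed.

Lemma eta0_nonsquare : exists a : 'F_p, eta0 p a = -1.
Proof.
have [z pz] := finField_prim_root 'F_p; rewrite card_Fp // in pz.
exists z; have := Fp_Euler z; case: (eta0_cases z) => -> //.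
  move/eqP; rewrite expf_eq0 (prim_root_eq0 pz) => /andP[_ /eqP p0].
  by have := odd_prime_gt2 p_odd p_pr; lia.
have := half_pred_double; have := odd_prime_gt2 p_odd p_pr => p3 p2.
move/eqP; rewrite -(prim_order_dvd pz) gtnNdvd //; lia.
Qed.

End PrimeField.

(** * Roots of unity *)

Section CyclotomicRelations.

Lemma map_poly_poly (R S : nzRingType) (h : {rmorphism R -> S}) (n : nat)
    (E : nat -> R) :
  map_poly h (\poly_(i < n) E i) = \poly_(i < n) h (E i).
Proof.
by apply/polyP => i; rewrite coef_map /= !coef_poly; case: ifP => _ //=; rewrite raddf0.
Qed.

Variables (p : nat) (z : algC).
Hypotheses (p_pr : prime p) (prim_z : p.-primitive_root z).

Lemma sum_prim_root : \sum_(i < p) z ^+ i = 0.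
Proof.
have z1 : z - 1 != 0.
  rewrite subr_eq0; apply: contraTneq (prime_gt1 p_pr) => z1.
  by rewrite -leqNgt dvdn_leq // (prim_order_dvd prim_z) z1 expr1n.
by apply: (mulfI z1); rewrite mulr0 -subrX1 (prim_expr_order prim_z) subrr.
Qed.

(** The divisor is monic, so the division stays over the integers. The remainder has degree below
    [p - 1], the degree of the minimal polynomial of [z], and vanishes at [z]; so it is zero. *)
Lemma prim_root_poly_int (P : {poly int}) :
  root (map_poly intr P) z -> exists S, P = S * \poly_(i < p) 1.
Proof.
move=> Pz0; pose Psi : {poly int} := \poly_(i < p) 1.
have sPsi : size Psi = p by rewrite size_poly_eq ?oner_eq0.
have Psim : Psi \is monic.
  by rewrite monicE lead_coefE sPsi coef_poly prednK ?prime_gt0 // leqnn.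
have Psiz : (map_poly intr Psi).[z] = 0 :> algC.
  rewrite map_poly_poly horner_poly -[RHS]sum_prim_root.
  by apply: eq_bigr => i _; rewrite mul1r.
have PE := Pdiv.RingMonic.rdivp_eq Psim P.
have := Pdiv.CommonRing.ltn_rmodpN0 P (monic_neq0 Psim).
rewrite sPsi; set r := Pdiv.CommonRing.rmodp P Psi in PE *; move=> sr.
exists (Pdiv.CommonRing.rdivp P Psi).
suff r0 : r = 0 by rewrite [LHS]PE r0 addr0.
have rz : root (map_poly intr r) z.
  move: Pz0; rewrite PE rmorphD rmorphM /= !rootE hornerD hornerM Psiz.
  by rewrite mulr0 add0r.
have rQ : map_poly (intr : int -> algC) r
          = map_poly ratr (map_poly (intr : int -> rat) r).
  by rewrite -map_poly_comp; apply: eq_map_poly => b; rewrite /= rmorph_int.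
have [m [mE mm] mP] := minCpolyP z.
have sm : size m = p.
  have := congr1 (fun q : {poly algC} => size q) mE.
  rewrite (minCpoly_cyclotomic prim_z) size_cyclotomic totient_prime //.
  by rewrite size_map_poly prednK ?prime_gt0.
apply/eqP/negPn/negP => r0; move: rz; rewrite rQ mP => /dvdp_leq.
have ii := @intr_inj rat.
rewrite (map_poly_eq0_id0) ?intr_eq0 ?lead_coef_eq0 // => /(_ r0).
by rewrite sm size_map_inj_poly // leqNgt sr.
Qed.

(** The polynomial with coefficients [c i] has degree below [p], so its quotient by
    [1 + X + ... + X^(p-1)] is a constant. *)
Lemma prim_root_int_relation (c : nat -> int) :
  \sum_(i < p) (c i)%:~R * z ^+ i = 0 -> forall i, (i < p)%N -> c i = c 0%N.
Proof.
move=> cz.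
have /prim_root_poly_int[S PE] : root (map_poly intr (\poly_(i < p) c i)) z.
  by rewrite rootE map_poly_poly horner_poly cz.
have sPsi : size (\poly_(i < p) (1 : int)) = p by rewrite size_poly_eq ?oner_eq0.
have p0 := prime_gt0 p_pr.
have sS : (size S <= 1)%N.
  have [->|S0] := eqVneq S 0; first by rewrite size_poly0.
  have Psi0 : \poly_(i < p) (1 : int) != 0 by rewrite -size_poly_eq0 sPsi; lia.
  have sm : size (S * \poly_(i < p) 1) = (size S + p).-1 by rewrite size_mul // sPsi.
  have : ((size S + p).-1 <= p)%N by rewrite -sm -PE size_poly.
  by move: (size S) => n; lia.
move=> i lt_ip; have E j : (j < p)%N -> c j = S`_0.
  move=> lt_jp; have := congr1 (fun P : {poly int} => P`_j) PE.
  by rewrite (size1_polyC sS) coefCM !coef_poly lt_jp coefC mulr1.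
by rewrite !E.
Qed.

Lemma big_Fp (V : nmodType) (g : nat -> V) :
  \sum_(s : 'F_p) g s = \sum_(i < p) g i.
Proof. by rewrite -!(big_mkord xpredT g) Fp_cast. Qed.

Lemma prim_root_Fp_relation (c : 'F_p -> int) :
  \sum_s (c s)%:~R * z ^+ s = 0 -> forall s, c s = c 0.
Proof.
move=> cz s.
have := @prim_root_int_relation (fun i => c (inord i)).
rewrite -(big_Fp (fun i => (c (inord i))%:~R * z ^+ i)) => cP.
rewrite -[s]inord_val -[X in _ = c X]inord_val; apply: cP; last first.
  by rewrite -[X in (_ < X)%N](Fp_cast p_pr).
by rewrite -[RHS]cz; apply: eq_bigr => i _; rewrite inord_val.
Qed.

Lemma sum_Fp_prim_root : \sum_(s : 'F_p) z ^+ s = 0.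
Proof. by rewrite big_Fp sum_prim_root. Qed.

(** Both sides are the value at 1 of [(X^p - 1) / (X - 1)]. *)
Lemma prod_sub_prim_root : \prod_(1 <= i < p) (1 - z ^+ i) = p%:R.
Proof.
have p1 := prime_gt1 p_pr; have p0 := prime_gt0 p_pr.
have := factor_Xn_sub_1 prim_z; rewrite big_ltn // expr0 subrX1.
move/(mulfI (negbT (polyXsubC_eq0 1))).
move/(congr1 (fun P : {poly algC} => P.[1])).
rewrite horner_prod horner_sum => E.
transitivity (\prod_(1 <= i < p) ('X - (z ^+ i)%:P).[1]).
  by apply: eq_bigr => i _; rewrite hornerXsubC.
rewrite E (eq_bigr (fun=> 1)) ?sumr_const ?card_ord // => i _.
by rewrite hornerXn expr1n.
Qed.

End CyclotomicRelations.

(** * The root of -1 of minimal argument *)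

Section PrimitiveRoot.

Variable p : nat.
Hypotheses (p_pr : prime p) (p_odd : odd p).

Let w : algC := p.-root (-1).

Lemma rootN1_exp : w ^+ p = -1.
Proof. by rewrite rootCK ?prime_gt0. Qed.

Lemma rootN1_norm : `|w| = 1.
Proof. by rewrite norm_rootC normrN1 rootC1 ?prime_gt0. Qed.

Lemma prime_prim_root (R : nzRingType) (z : R) :
  z ^+ p = 1 -> z != 1 -> p.-primitive_root z.
Proof.
move=> zp z1; have [m pm mp] := prim_order_exists (prime_gt0 p_pr) zp.
have [m1|m1] := eqVneq m 1%N; last by rewrite (prime_nt_dvdP p_pr m1 mp) in pm.
by move: z1; have := prim_expr_order pm; rewrite m1 expr1 => ->; rewrite eqxx.
Qed.

Lemma zeta_neq1 : zeta p != 1.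
Proof.
apply/negP; rewrite /zeta sqrf_eq1 rootC_eq1 ?prime_gt0 // => /orP[/eqP N11|/eqP w1].
  by have := ltrN10 algC; rewrite N11 ltr10.
by have := rootC_lt0 (-1 : algC) (prime_gt1 p_pr); rewrite w1 ltrN10.
Qed.

Lemma zeta_prim : p.-primitive_root (zeta p).
Proof.
apply: prime_prim_root zeta_neq1.
by rewrite /zeta -exprM mulnC exprM rootN1_exp sqrrN expr1n.
Qed.

Lemma oppr_rootN1_prim : p.-primitive_root (- w).
Proof.
apply: prime_prim_root; first by rewrite exprNn -signr_odd p_odd rootN1_exp mulrNN mulr1.
by apply: contraNneq zeta_neq1 => w1; rewrite /zeta -sqrrN -/w w1 expr1n.
Qed.

(** For arguments [s], [t] in (0, pi) with [s + t <= pi], this is [cos (s + t) < cos s].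
    Algebraically, the difference of the real parts times [1 + 'Re y] is
    [('Im (x * y) + 'Im x) * 'Im y]. *)
Lemma unit_Re_mul_lt (x y : algC) :
  `|x| = 1 -> `|y| = 1 -> 0 < 'Im x -> 0 < 'Im y -> 0 <= 'Im (x * y) ->
  'Re (x * y) < 'Re x.
Proof.
move=> nx ny ix iy; rewrite ImM ReM => ixy.
have := normC2_Re_Im y; rewrite ny expr1n.
move: ('Re y) ('Im y) (Creal_Re y) iy ixy => c d rc d0 ixy E.
have c1 : 0 < 1 + c.
  rewrite addrC -ltrBlDr sub0r.
  have : c ^+ 2 < 1 by rewrite E ltrDl exprn_gt0.
  by rewrite -real_normK // expr_lt1 // real_ltr_norml // => /andP[].
rewrite -subr_gt0 -(pmulr_rgt0 _ c1).
rewrite (_ : (1 + c) * _ = ('Re x * d + c * 'Im x) * d + 'Im x * d); last first.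
  have d2 : d ^+ 2 = 1 - c ^+ 2 by rewrite E addrAC subrr add0r.
  transitivity ('Re x * (1 - c ^+ 2) + 'Im x * d * (1 + c)); first by ring.
  by rewrite -d2; ring.
by rewrite ltr_wpDl ?mulr_ge0 ?mulr_gt0 // ltW.
Qed.

(* If w ^ k is above the real axis and w ^ (k+1) below it, then w is the product
   of - w^-k and - w^(k+1), both above the axis; one of them is a p-th root of -1,
   and its real part exceeds that of w, against the choice of w. *)
Lemma rootN1_Im_gt0 k : (0 < k < p)%N -> 0 < 'Im (w ^+ k).
Proof.
have p1 := prime_gt1 p_pr.
have nw j : `|w ^+ j| = 1 by rewrite normrX rootN1_norm expr1n.
have w2 : w ^+ 2 = zeta p by [].
have nIm j : (0 < j < p)%N -> 'Im (w ^+ j) != 0.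
  move=> /andP[j0 jp]; apply/negP => /eqP/Creal_ImP rj.
  have : (w ^+ j) ^+ 2 == 1 by rewrite -real_normK // nw expr1n.
  rewrite -exprM mulnC exprM w2 -(prim_order_dvd zeta_prim) gtnNdvd //.
have Re_max y : y ^+ p = -1 -> 0 < 'Im y -> 'Re y <= 'Re w.
  by move=> yp /ltW; apply: rootC_Re_max => //; apply: prime_gt0.
have iw : 0 < 'Im w by rewrite lt0r -{1}(expr1 w) nIm ?Im_rootC_ge0.
elim: k => [//|k IH /andP[_ kp]].
have [->//|k0] := posnP k; have {IH}ik : 0 < 'Im (w ^+ k) by apply: IH; lia.
rewrite real_ltNge ?Creal_Im ?real0 //; apply/negP => ikS.
have {}ikS : 0 < 'Im (- w ^+ k.+1).
  by rewrite raddfN /= oppr_gt0 lt_neqAle ikS nIm.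
have ww : w = (- (w ^+ k)^-1) * (- w ^+ k.+1).
  have wk0 : w ^+ k != 0 by rewrite -normr_eq0 nw oner_eq0.
  by rewrite mulrNN exprSr mulKf.
have nV : `|- (w ^+ k)^-1| = 1.
  by rewrite normrN normrV ?nw ?invr1 // unitfE -normr_eq0 nw oner_eq0.
have iV : 0 < 'Im (- (w ^+ k)^-1).
  by rewrite raddfN /= ImV nw expr1n invr1 mulr1 opprK.
have wkp j : (w ^+ j) ^+ p = (-1) ^+ j by rewrite -exprM mulnC exprM rootN1_exp.
have no y : 'Re w < 'Re y -> y ^+ p = -1 -> 0 < 'Im y -> False.
  by move=> wy yp /(Re_max y yp) /(lt_le_trans wy); rewrite ltxx.
(* The factor that is a [p]-th root of -1 is the one whose exponent, [k] or [k + 1], is even. *)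
have [ok|ek] := boolP (odd k).
  have := @unit_Re_mul_lt (- w ^+ k.+1) (- (w ^+ k)^-1).
  rewrite mulrC -ww => h; apply: no (h _ _ _ _ _) _ _ => //; rewrite ?normrN // ?ltW //.
  by rewrite exprNn wkp -signr_odd p_odd -[_ ^+ k.+1]signr_odd /= ok expr1 mulr1.
have := @unit_Re_mul_lt (- (w ^+ k)^-1) (- w ^+ k.+1).
rewrite -ww => h; apply: no (h _ _ _ _ _) _ _ => //; rewrite ?normrN // ?ltW //.
by rewrite exprNn exprVn wkp -signr_odd p_odd -[_ ^+ k]signr_odd (negPf ek) invr1 mulr1.
Qed.

End PrimitiveRoot.

(** * The quadratic Gauss sum *)

Lemma natr_ffact (R : pzRingType) (n m : nat) :
  (n ^_ m)%:R = \prod_(i < m) (n%:R - i%:R) :> R.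
Proof.
elim: m => [|m IH]; first by rewrite big_ord0.
rewrite big_ord_recr /= -IH ffactnSr natrM.
have [lt_nm|le_mn] := ltnP n m; first by rewrite ffact_small ?mul0r.
by rewrite natrB.
Qed.

Lemma size_coef_prod_quadratic (R : comNzRingType) (c : R) (a : nat -> R) (n : nat) :
  let L : {poly R} := \prod_(i < n) (c *: 'X^2 - (a i)%:P) in
  (size L <= n.*2.+1)%N /\ L`_(n.*2) = c ^+ n.
Proof.
elim: n => [|n [sL cL]] /=; first by rewrite big_ord0 size_poly1 coef1.
rewrite big_ord_recr /=; set L := \prod_(i < n) _ in sL cL *.
split.
  apply: leq_trans (size_polyMleq _ _) _.
  have : (size (c *: 'X^2 - (a n)%:P : {poly R})%R <= 3)%N.
    rewrite (leq_trans (size_polyD _ _)) // geq_max size_polyN.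
    rewrite (leq_trans (size_scale_leq _ _)) ?size_polyXn //.
    by rewrite (leq_trans (size_polyC_leq1 _)).
  rewrite doubleS; lia.
rewrite mulrBr coefB -scalerAr coefZ coefMXn doubleS /= subn2 /= cL.
by rewrite coefMC [L`__]nth_default ?mul0r ?subr0 ?exprS // (leq_trans sL).
Qed.

(** Each factor is divisible by [X], so degree [n] is the lowest that can occur and only the linear
    coefficients contribute to it. *)
Lemma coef_prod_mulX (R : comNzRingType) (Q : nat -> {poly R}) (n : nat) :
  (forall i, (Q i)`_0 = 0) ->
  (\prod_(i < n) Q i)`_n = \prod_(i < n) (Q i)`_1.
Proof.
move=> Q0; pose q i := drop_poly 1 (Q i).
have QE i : Q i = q i * 'X.
  rewrite -[LHS](poly_take_drop 1) [take_poly 1 _](_ : _ = 0) ?add0r //.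
  by apply/polyP => j; rewrite coef_take_poly coef0; case: j => //=.
rewrite (eq_bigr (fun i : 'I_n => q i * 'X)) // big_split /= prodr_const card_ord.
rewrite coefMXn ltnn subnn coef0_prod; apply: eq_bigr => i _.
by rewrite coef_drop_poly.
Qed.

Lemma coef_X1_exp (R : comNzRingType) (n m : nat) :
  (('X + 1 : {poly R}) ^+ n)`_m = 'C(n, m)%:R.
Proof.
rewrite exprDn coef_sum.
have [lt_nm|le_mn] := ltnP n m.
  rewrite bin_small // big1 // => i _.
  rewrite expr1n mulr1 coefMn coefXn; case: eqP => [mi|]; last by rewrite mul0rn.
  by have := ltn_ord i; lia.
have lt : (n - m < n.+1)%N by lia.
rewrite (bigD1 (Ordinal lt)) //= big1 ?addr0.
  by rewrite expr1n mulr1 coefMn coefXn subKn // eqxx bin_sub.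
move=> i ni; rewrite expr1n mulr1 coefMn coefXn.
case: eqP => [mi|]; last by rewrite mul0rn.
by case/negP: ni; apply/eqP/val_inj => /=; have := ltn_ord i; lia.
Qed.

Definition zchar (p : nat) (a : 'F_p) : algC := zeta p ^+ nat_of_ord a.
Arguments zchar : clear implicits.

Section GaussSum.

Variable p : nat.
Hypotheses (p_pr : prime p) (p_odd : odd p).

Let m := (p.-1)./2.
Let w : algC := p.-root (-1).
(** As [p] is odd, this is a primitive [p]-th root of unity, unlike [w], and it is still a square
    root of [zeta p]. *)
Let om := - w.
Let zp : zeta p ^+ p = 1 := prim_expr_order (zeta_prim p_pr).
Let omp : om ^+ p = 1 := prim_expr_order (oppr_rootN1_prim p_pr p_odd).

Lemma prod_nat_pair (R : comPzRingType) (h : nat -> R) :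
  \prod_(1 <= i < p) h i = \prod_(k < m) (h k.+1 * h (p - k.+1)%N).
Proof.
have p2 := half_pred_double p_odd; have p3 := odd_prime_gt2 p_odd p_pr.
rewrite (@big_cat_nat _ _ _ m.+1) /=; [|by lia|rewrite /m; lia].
rewrite big_split /= big_add1 /= big_mkord; congr (_ * _).
rewrite big_nat_rev /= -{1}[m.+1]add0n big_addn.
rewrite (_ : (p - m.+1)%N = m); last by rewrite /m; lia.
rewrite big_mkord; apply: eq_bigr => i _; congr h.
have := ltn_ord i; rewrite /m; lia.
Qed.

Lemma zeta_norm : `|zeta p| = 1.
Proof. by rewrite /zeta normrX rootN1_norm ?expr1n. Qed.

Lemma zcharD (a b : 'F_p) : zchar p (a + b) = zchar p a * zchar p b.
Proof. exact: expr_FpD. Qed.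

Lemma zchar_conj (a : 'F_p) : (zchar p a)^* = zchar p (- a).
Proof.
have na : `|zchar p a| = 1 by rewrite normrX zeta_norm expr1n.
have z0 : zchar p a != 0 by rewrite -normr_eq0 na oner_eq0.
by apply: (mulfI z0); rewrite -zcharD subrr -normCK na expr1n.
Qed.

Lemma sum_zchar : \sum_s zchar p s = 0.
Proof. exact: sum_Fp_prim_root (zeta_prim p_pr). Qed.

Lemma sum_zchar_mul (a : 'F_p) :
  \sum_y zchar p (a * y) = if a == 0 then p%:R else 0.
Proof.
case: eqP => [->|/eqP a0].
  under eq_bigr => y _ do rewrite mul0r.
  by rewrite sumr_const -[#|_|]/#|'F_p| card_Fp.
by rewrite -[RHS]sum_zchar [RHS](reindex_inj (mulfI a0)).
Qed.

Let g := \sum_(x : 'F_p) zchar p (x ^+ 2).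

Lemma gauss_eta : g = \sum_s zchar p s *~ eta0 p s.
Proof. by rewrite /g (sum_Fp_sqr p_pr p_odd) sum_zchar add0r. Qed.

(** After the substitution [x = y + d], the sum over [y] is a full character sum, which vanishes
    unless [d = 0]. *)
Lemma gauss_norm : g * g^* = p%:R.
Proof.
rewrite /g rmorph_sum big_distrlr exchange_big /=.
transitivity (\sum_y \sum_d zchar p (d ^+ 2) * zchar p (d *+ 2 * y)).
  apply: eq_bigr => y _; rewrite (reindex_inj (addrI y)) /=; apply: eq_bigr => d _.
  by rewrite zchar_conj -!zcharD; congr (zchar p _); ring.
rewrite exchange_big /=.
under eq_bigr => d _ do rewrite -mulr_sumr sum_zchar_mul.
rewrite (bigD1 0) // mul0rn eqxx expr0n mul1r big1 => [|d d0]; first exact: addr0.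
rewrite -[d *+ 2]mulr_natr mulf_eq0; move: d0 => /= /negPf ->.
by rewrite -[2%:R]/(1 + 1) addr_eq0 eq_sym (negPf (Fp_N1_neq1 p_pr p_odd)) mulr0.
Qed.

(** Conjugation replaces [s] by [-s] in [gauss_eta], hence multiplies [g] by [eta0 p (-1)]; the norm
    then gives the square. *)
Lemma gauss_sqr : g ^+ 2 = (-1) ^+ m * p%:R.
Proof.
have gc : g^* = (-1) ^+ m * g.
  rewrite gauss_eta rmorph_sum (reindex_inj oppr_inj) big_distrr /=.
  apply: eq_bigr => s _; rewrite rmorphMz /= zchar_conj opprK eta0N // eta0_N1 //.
  by rewrite mulrC mulrzA -[_ *~ _ ^+ _]mulrzl rmorph_sign mulrzAr.
have a1 : (-1) ^+ m * (-1) ^+ m = 1 :> algC.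
  by rewrite -exprD -signr_odd addnn odd_double.
transitivity ((-1) ^+ m * (-1) ^+ m * g ^+ 2); first by rewrite a1 mul1r.
by rewrite -gauss_norm gc; ring.
Qed.

Let B := \prod_(k < m) (om ^+ k.+1 - om ^+ (p - k.+1)).

Lemma om_conj k : (k <= p)%N -> (om ^+ k)^* = om ^+ (p - k).
Proof.
move=> kp; have n1 : om ^+ k * (om ^+ k)^* = 1.
  by rewrite -normCK normrX normrN rootN1_norm // !expr1n.
have z0 : om ^+ k != 0 by apply/eqP => z0; move/eqP: n1; rewrite z0 mul0r eq_sym oner_eq0.
by apply: (mulfI z0); rewrite n1 -exprD subnKC.
Qed.

(** In the product of the [1 - zeta^i], which is [p], the indices [i] and [p - i] are paired: if
    [u v = 1], then [(1 - u^2) (1 - v^2) = - (u - v)^2]. *)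
Lemma sineprod_sqr : B ^+ 2 = (-1) ^+ m * p%:R.
Proof.
have p2 := half_pred_double p_odd; have p3 := odd_prime_gt2 p_odd p_pr.
rewrite -(prod_sub_prim_root p_pr (zeta_prim p_pr)) prod_nat_pair /B.
rewrite -prodrXl -[m in (-1) ^+ m]card_ord -prodr_const -big_split /=.
apply: eq_bigr => k _; have kp : (k.+1 <= p)%N by have := ltn_ord k; rewrite /m; lia.
have -> : zeta p = om ^+ 2 by rewrite sqrrN.
rewrite -!exprM -![(2 * _)%N]mulnC !exprM.
have : om ^+ k.+1 * om ^+ (p - k.+1) = 1 by rewrite -exprD subnKC.
move: (om ^+ k.+1) (om ^+ (p - k.+1)) => u v uv.
transitivity (u ^+ 2 + v ^+ 2 - 2 * (u * v)); first by ring.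
transitivity (u ^+ 2 + v ^+ 2 - 1 - (u * v) ^+ 2); last by ring.
rewrite uv; ring.
Qed.

(* Modulo p, 1 + X + ... + X^(p-1) is (X - 1)^(p-1). *)
Lemma coef_shift_modp (z : algC) (P : {poly int}) (k : nat) :
  p.-primitive_root z -> root (map_poly intr P) z -> (k < p.-1)%N ->
  (map_poly (intr : int -> 'F_p) P \Po ('X + 1))`_k = 0.
Proof.
move=> pz /(prim_root_poly_int p_pr pz)[S ->] kp.
rewrite rmorphM /= comp_polyM.
suff -> : map_poly intr (\poly_(i < p) 1) \Po ('X + 1) = 'X^(p.-1) :> {poly 'F_p}.
  by rewrite coefMXn kp.
apply: (mulfI (negbT (polyX_eq0 'F_p))).
have -> : map_poly intr (\poly_(i < p) 1) = \sum_(i < p) 'X^i :> {poly 'F_p}.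
  by rewrite map_poly_poly poly_def; apply: eq_bigr => i _; rewrite scale1r.
transitivity ((('X - 1) * \sum_(i < p) 'X^i) \Po ('X + 1) : {poly 'F_p}).
  by rewrite comp_polyM comp_polyB comp_polyX comp_polyC addrK.
rewrite -subrX1 comp_polyB comp_polyC comp_Xn_poly exprDn_pchar.
  by rewrite expr1n addrK -exprS prednK // prime_gt0.
rewrite pnatE //; rewrite pchar_poly; exact: pchar_Fp.
Qed.

(* Both sides have the same square; the sign is read off the coefficients of
   (X - 1)^m modulo p, using Wilson's theorem. *)
Lemma gauss_sineprod : g = (-1) ^+ m * B.
Proof.
have p2 := half_pred_double p_odd; have p3 := odd_prime_gt2 p_odd p_pr.
have : g ^+ 2 == B ^+ 2 by rewrite gauss_sqr sineprod_sqr.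
rewrite eqf_sqr => gB.
have [b {}gB] : exists b : bool, g = (-1) ^+ b * B.
  by case/orP: gB => /eqP ->; [exists false | exists true]; rewrite ?mul1r ?mulN1r.
suff -> : (-1) ^+ m = (-1) ^+ b :> algC by [].
(* Since [om ^+ 2 = zeta p], the value of [P] at [om] is [g - (-1) ^+ b * B], which is zero. Its
   coefficient of degree [m] in [X - 1] is now computed modulo [p]. *)
pose P : {poly int} := \sum_(x : 'F_p) 'X^(2 * (x ^+ 2)%R)
   - ((-1) ^+ b)%:P * \prod_(k < m) ('X^(k.+1) - 'X^(p - k.+1)).
have Pom : root (map_poly intr P) om.
  rewrite rootE /P rmorphB rmorphM rmorph_prod rmorph_sum /=.
  rewrite hornerD hornerN hornerM horner_sum horner_prod subr_eq0.
  rewrite (eq_bigr (fun x : 'F_p => zchar p (x ^+ 2))); last first.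
    by move=> x _; rewrite map_polyXn hornerXn exprM sqrrN.
  rewrite -/g gB map_polyC hornerC /= rmorph_sign; apply/eqP; congr (_ * _).
  by apply: eq_bigr => k _; rewrite rmorphB /= !map_polyXn hornerD hornerN !hornerXn.
have mp : (m < p.-1)%N by rewrite /m; lia.
have := coef_shift_modp (oppr_rootN1_prim p_pr p_odd) Pom mp.
rewrite /P rmorphB rmorphM rmorph_prod rmorph_sum /= comp_polyB comp_polyM.
rewrite (rmorph_sum (comp_poly _)) (rmorph_prod (comp_poly _)) map_polyC comp_polyC.
rewrite coefB coefCM coef_sum /= rmorph_sign.
pose Q k : {poly 'F_p} := ('X + 1) ^+ k.+1 - ('X + 1) ^+ (p - k.+1).
rewrite (eq_bigr (fun x : 'F_p => 'C(2 * (x ^+ 2)%R, m)%:R)); last first.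
  by move=> x _; rewrite map_polyXn comp_Xn_poly coef_X1_exp.
rewrite (eq_bigr (fun k : 'I_m => Q k)); last first.
  by move=> k _; rewrite rmorphB /= !map_polyXn comp_polyB !comp_Xn_poly.
(* The linear coefficient of [Q k] is [(k + 1) - (p - k - 1)], that is [2 (k + 1)] modulo [p]; the
   product contributes [2^m m!]. *)
rewrite coef_prod_mulX; last by move=> k; rewrite coefB !coef_X1_exp !bin0 subrr.
rewrite (eq_bigr (fun k : 'I_m => 2 * k.+1%:R)); last first.
  move=> k _; rewrite coefB !coef_X1_exp !bin1 natrB; last first.
    by have := ltn_ord k; rewrite /m; lia.
  by rewrite pchar_Fp_0 //; ring.
rewrite big_split prodr_const card_ord /= => /eqP; rewrite subr_eq0 => /eqP E1.
have mfact : (m`!)%:R = \prod_(k < m) (k.+1)%:R :> 'F_p.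
  by rewrite fact_prod big_add1 /= big_mkord natr_prod.
have two0 : 2%:R != 0 :> 'F_p.
  by rewrite -[2%:R]/(1 + 1) addr_eq0 eq_sym Fp_N1_neq1.
(* Times [m!], the binomial coefficient is the falling factorial of [2 x^2], a polynomial in [x] of
   degree [2 m = p - 1] with leading coefficient [2^m]. *)
have E2 : \sum_(x : 'F_p) 'C(2 * (x ^+ 2)%R, m)%:R * (m`!)%:R = - 2%:R ^+ m :> 'F_p.
  pose L : {poly 'F_p} := \prod_(i < m) (2%:R *: 'X^2 - (i%:R)%:P).
  have [sL cL] := size_coef_prod_quadratic (2%:R : 'F_p) (fun i => i%:R) m.
  rewrite -cL -addnn p2 -[X in _`_X.-1](card_Fp p_pr) -sum_finField_horner; last first.
    by rewrite card_Fp // (leq_trans sL) // -addnn p2 prednK ?prime_gt0.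
  apply: eq_bigr => x _; rewrite -natrM bin_ffact natr_ffact horner_prod.
  apply: eq_bigr => i _; rewrite hornerD hornerN hornerC hornerZ hornerXn.
  by rewrite natrM natr_Zp.
(* Wilson's theorem with the factors [i] and [p - i] paired. *)
have W : (-1 : 'F_p) = (-1) ^+ m * (m`!)%:R ^+ 2.
  have := Wilson (prime_gt1 p_pr); rewrite p_pr => /esym.
  rewrite (dvdn_pcharf (pchar_Fp p_pr)) -natr1 addr_eq0 => /eqP W0.
  transitivity ((p.-1)`!%:R : 'F_p); first by rewrite W0.
  rewrite fact_prod natr_prod prednK ?prime_gt0 // (@prod_nat_pair 'F_p (fun i => i%:R)).
  rewrite mfact -prodrXl -[m in (-1) ^+ m]card_ord -prodr_const -big_split /=.
  apply: eq_bigr => k _; rewrite natrB; last by have := ltn_ord k; rewrite /m; lia.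
  by rewrite pchar_Fp_0 //; ring.
(* [E1] and [E2] give [- 2^m = (-1)^b 2^m m!^2], and [W] gives [m!^2 = - (-1)^m]. As -1 and 1 differ
   in ['F_p], the signs agree. *)
have : (2%:R : 'F_p) ^+ m * 1 = 2%:R ^+ m * ((-1) ^+ m * (-1) ^+ b).
  have mm : (-1) ^+ m * (-1) ^+ m = 1 :> 'F_p.
    by rewrite -exprD -signr_odd addnn odd_double.
  have F2 : (m`!)%:R ^+ 2 = - (-1) ^+ m :> 'F_p.
    transitivity ((-1) ^+ m * (-1) ^+ m * (m`!)%:R ^+ 2 : 'F_p).
      by rewrite mm mul1r.
    by rewrite -mulrA -W mulrN1.
  rewrite mulr1 -[LHS]opprK -E2 -big_distrl /= E1 -mfact.
  transitivity (- ((-1) ^+ b * 2%:R ^+ m * (m`!)%:R ^+ 2) : 'F_p); first by ring.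
  by rewrite F2; ring.
move/(mulfI (expf_neq0 _ two0)).
rewrite -[X in _ = X * _ -> _]signr_odd -[X in _ -> X = _]signr_odd.
case: (odd m) b {P Pom E1 gB} => [] [] //=; rewrite ?expr0 ?expr1 ?mulr1 ?mul1r => /eqP;
  by rewrite eq_sym (negPf (Fp_N1_neq1 p_pr p_odd)).
Qed.

(** Collects the phases of the differences [om^k - om^(-k) = (-1)^k 'i (2 'Im (w^k))]. Two further
    factors leave the left side unchanged, so only the parity of [n] matters. *)
Lemma sign_i_prod n :
  (-1) ^+ n * \prod_(k < n) ((-1) ^+ k.+1 * 'i) = (if odd n then 'i else 1) :> algC.
Proof.
have step k (u : algC) :
    (-1) ^+ k.+2 * (u * ((-1) ^+ k.+1 * 'i) * ((-1) ^+ k.+2 * 'i)) = (-1) ^+ k * u.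
  transitivity ((-1) ^+ k * u * ((-1) ^+ k) ^+ 2 * - 'i ^+ 2).
    by rewrite !exprS; ring.
  by rewrite sqrCi sqrr_sign opprK !mulr1.
have [j ->] : exists j, n = (odd n + j.*2)%N by exists n./2; rewrite odd_double_half.
rewrite oddD odd_double addbF oddb; elim: j => [|j IH].
  by case: odd; rewrite ?big_ord_recr big_ord0 //= ?expr0 ?expr1; ring.
by rewrite doubleS !addnS !big_ord_recr /= step IH.
Qed.

Lemma gauss_sum : g = sqrt_pstar p.
Proof.
(* [T] is a positive real of square [p], so it is the positive square root; this is where the choice
   of [w] fixes the sign. *)
pose T := \prod_(k < m) ('Im (w ^+ k.+1) *+ 2).
have p2 := half_pred_double p_odd; have p3 := odd_prime_gt2 p_odd p_pr.
have T0 : 0 < T.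
  apply: prodr_gt0 => k _; rewrite pmulrn_lgt0 // rootN1_Im_gt0 //.
  by have := ltn_ord k; rewrite /m; lia.
have gT : g = (if odd m then 'i else 1) * T.
  rewrite gauss_sineprod -sign_i_prod -mulrA -big_split /=; congr (_ * _).
  apply: eq_bigr => k _; rewrite -om_conj; last by have := ltn_ord k; rewrite /m; lia.
  have uE (u : algC) : u - u^* = 'i * ('Im u *+ 2).
    rewrite {1 2}[u]Crect conjC_rect ?Creal_Re ?Creal_Im //; ring.
  rewrite /om (exprNn w) rmorphM rmorph_sign /= -mulrBr uE; ring.
have T2 : T ^+ 2 = p%:R.
  have := gauss_sqr; rewrite gT exprMn -[(-1) ^+ m]signr_odd.
  case: odd; rewrite ?expr1n ?mul1r ?expr0 ?mul1r // sqrCi => /(mulfI _) -> //.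
  by rewrite oppr_eq0 oner_eq0.
have -> : g = (if odd m then 'i else 1) * sqrtC p%:R.
  by rewrite -T2 sqrCK ?ltW // -gT.
rewrite /sqrt_pstar; have -> : (p %% 4 == 1)%N = ~~ odd m.
  rewrite /m; lia.
by case: odd; rewrite ?mul1r.
Qed.

End GaussSum.

(** * The trace *)

Section Trace.

Variables (p e : nat) (F : finFieldType).
Hypotheses (p_pr : prime p) (pcF : p \in [pchar F]) (cF : #|F| = (p ^ e)%N).

Lemma ofFp_is_zmod_morphism : zmod_morphism (@ofFp p F).
Proof.
have D a b : ofFp p (a + b) = ofFp p a + ofFp p b :> F.
  by rewrite /ofFp val_FpD // (GRing.natr_mod_pchar pcF) natrD.
move=> a b; apply: (addIr (ofFp p b)); by rewrite -D !subrK.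
Qed.

Lemma ofFp_is_monoid_morphism : monoid_morphism (@ofFp p F).
Proof.
split=> [|a b]; first exact: (mulr1n 1).
by rewrite /ofFp val_FpM // (GRing.natr_mod_pchar pcF) natrM.
Qed.

HB.instance Definition _ :=
  GRing.isZmodMorphism.Build 'F_p F (@ofFp p F) ofFp_is_zmod_morphism.
HB.instance Definition _ :=
  GRing.isMonoidMorphism.Build 'F_p F (@ofFp p F) ofFp_is_monoid_morphism.

Let phi : {rmorphism 'F_p -> F} := @ofFp p F.

Lemma ofFp_inj : injective (@ofFp p F).
Proof. exact: fmorph_inj phi. Qed.

(** The [p] images of ['F_p] are roots of [X^p - X]; a [y] outside the prime subfield would be one
    root too many. *)
Lemma toFpK (y : F) : y ^+ p = y -> ofFp p (toFp p y) = y.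
Proof.
move=> yp; rewrite /toFp; case: pickP => [k /eqP //|no].
pose P : {poly F} := 'X^p - 'X; have p1 := prime_gt1 p_pr.
have sP : size P = p.+1 by rewrite size_polyDl size_polyXn // size_polyN size_polyX.
pose rs := y :: [seq ofFp p a | a : 'F_p].
have : (size rs < size P)%N.
  apply: max_poly_roots; first by rewrite -size_poly_gt0 sP.
    apply/allP => x; rewrite inE rootE !hornerE => /orP[/eqP ->|/mapP[a _ ->]].
      by rewrite yp subrr.
    rewrite -[ofFp p a]/(phi a) -rmorphXn /= subr_eq0 -[X in a ^+ X](card_Fp p_pr).
    by rewrite expf_card.
  rewrite /= map_inj_uniq ?enum_uniq ?andbT; last exact: ofFp_inj.
  by apply/negP => /mapP[a _ ya]; have := no a; rewrite -[_%:R]/(ofFp p a) -ya eqxx.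
by rewrite /= size_map -cardE card_Fp // sP ltnn.
Qed.

Let T (x : F) := \sum_(i < e) x ^+ (p ^ i).

Lemma exprD_pXn (x y : F) i : (x + y) ^+ (p ^ i) = x ^+ (p ^ i) + y ^+ (p ^ i).
Proof. by apply: exprDn_pchar; rewrite pnatX pnatE ?pcF. Qed.

(** Frobenius permutes the terms of the sum cyclically, so the sum lies in the prime subfield and
    the default value of [toFp] never occurs. *)
Lemma ofFp_trace (x : F) : ofFp p (trace p e x) = T x.
Proof.
apply: toFpK; rewrite -/(T x) /T.
have -> : (\sum_(i < e) x ^+ (p ^ i)) ^+ p = \sum_(i < e) x ^+ (p ^ i.+1).
  rewrite -[LHS]/(pFrobenius_aut pcF _) rmorph_sum; apply: eq_bigr => i _ /=.
  by rewrite pFrobenius_autE -exprM -expnSr.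
have : x ^+ (p ^ e) = x by rewrite -cF expf_card.
case: (e) => [|n] xe; first by rewrite !big_ord0.
by rewrite big_ord_recr [RHS]big_ord_recl /= xe expr1 addrC.
Qed.

Lemma traceD (x y : F) : trace p e (x + y) = trace p e x + trace p e y.
Proof.
apply: ofFp_inj; rewrite -[RHS]/(phi _) rmorphD /= !ofFp_trace /T -big_split /=.
by apply: eq_bigr => i _; rewrite exprD_pXn.
Qed.

Lemma traceZ (a : 'F_p) (x : F) : trace p e (ofFp p a * x) = a * trace p e x.
Proof.
apply: ofFp_inj; rewrite -[RHS]/(phi _) rmorphM /= !ofFp_trace /T big_distrr /=.
apply: eq_bigr => i _; rewrite exprMn; congr (_ * _).
rewrite -[ofFp p a]/(phi a) -rmorphXn; congr (phi _).
elim: (i : nat) => [|k IH]; first by rewrite expr1.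
by rewrite expnSr exprM IH -{2}[a]expf_card card_Fp.
Qed.

Lemma trace0 : trace p e (0 : F) = 0.
Proof. by apply: (addrI (trace p e (0 : F))); rewrite -traceD !addr0. Qed.

Lemma traceN (x : F) : trace p e (- x) = - trace p e x.
Proof. by apply/eqP; rewrite -addr_eq0 -traceD addNr trace0. Qed.

Lemma trace_sum (I : finType) (h : I -> F) :
  trace p e (\sum_i h i) = \sum_i trace p e (h i).
Proof. exact: (big_morph _ traceD trace0). Qed.

Hypothesis e0 : (0 < e)%N.

(** As a polynomial the trace has degree [p ^ e.-1], too small to vanish on all of [F]. *)
Lemma trace_neq0 : exists x : F, trace p e x != 0.
Proof.
have [/existsP//|] := boolP [exists x : F, trace p e x != 0].
rewrite negb_exists => /forallP tr0; exfalso.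
pose P : {poly F} := \sum_(i < e) 'X^(p ^ i).
have p1 := prime_gt1 p_pr.
have sP n : (0 < n)%N -> size (\sum_(i < n) 'X^(p ^ i) : {poly F}) = (p ^ n.-1).+1.
  case: n => // n _; elim: n => [|n IH]; first by rewrite big_ord1 size_polyXn.
  by rewrite big_ord_recr /= addrC size_polyDl ?size_polyXn // IH ltnS ltn_exp2l.
have : (size (enum F) < size P)%N.
  apply: max_poly_roots; rewrite ?enum_uniq //; first by rewrite -size_poly_gt0 sP.
  apply/allP => x _; rewrite rootE horner_sum.
  under eq_bigr => i _ do rewrite hornerXn.
  by rewrite -[X in X == 0]/(T x) -ofFp_trace; have := tr0 x; rewrite negbK => /eqP ->.
by rewrite -cardE cF sP // ltnS leq_exp2l // leqNgt prednK ?leqnn.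
Qed.

Lemma trace_mul_eq0 (x : F) : (forall y, trace p e (y * x) = 0) -> x = 0.
Proof.
move=> h; apply/eqP/negPn/negP => x0; have [y /negP[]] := trace_neq0.
by rewrite -(h (y / x)) divfK.
Qed.

Lemma card_trace_fiber (c : F) (a : 'F_p) :
  c != 0 -> #|[set x : F | trace p e (c * x) + a == 0]| = (p ^ e.-1)%N.
Proof.
move=> c0; have [y ty] := trace_neq0.
(* Normalised so that [c * x1] has trace 1; translations by multiples of [x1] identify all the
   fibres. *)
pose x1 := ofFp p (trace p e y)^-1 * (y / c).
have tx1 b : trace p e (c * (ofFp p b * x1)) = b.
  by rewrite /x1 mulrCA traceZ mulrCA traceZ [c * _]mulrCA divff // mulr1 mulVf // mulr1.
pose A (b : 'F_p) := [set x : F | trace p e (c * x) == b].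
have cA b : #|A b| = #|A 0|.
  rewrite -(card_imset (mem (A 0)) (addIr (ofFp p b * x1))); apply: eq_card => x.
  rewrite !inE; apply/idP/imsetP => [/eqP xb|[z]]; last first.
    by rewrite inE => /eqP z0 ->; rewrite mulrDr traceD z0 tx1 add0r.
  exists (x - ofFp p b * x1); last by rewrite subrK.
  by rewrite inE mulrBr traceD traceN tx1 xb subrr.
have : #|F| = (#|'F_p| * #|A 0%R|)%N.
  rewrite -[LHS]sum1_card (partition_big (fun x => trace p e (c * x)) predT) //=.
  rewrite -sum_nat_const; apply: eq_bigr => b _.
  by rewrite sum1_card -(cA b); apply: eq_card => x; rewrite !inE.
rewrite cF card_Fp //.
rewrite -{1}(prednK e0) expnS => /eqP; rewrite eqn_pmul2l ?prime_gt0 // => /eqP ->.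
by rewrite -(cA (- a)); apply: eq_card => x; rewrite !inE addr_eq0.
Qed.

Section Powers.

Variable beta : F.
Hypothesis beta_prim : (#|F|.-1).-primitive_root beta.

(** A nontrivial relation is a nonzero [Q] of degree [k < e] with root [beta]. Every element of [F]
    is a polynomial in the generator [beta], so reducing modulo [Q] would leave at most [p ^ k]
    elements. *)
Lemma sum_powers_eq0 (c : 'I_e -> 'F_p) :
  \sum_i ofFp p (c i) * beta ^+ i = 0 -> forall i, c i = 0.
Proof.
move=> c0 i0; pose cc (i : nat) := odflt 0 (omap c (insub i)).
have ccE (i : 'I_e) : cc i = c i by rewrite /cc valK.
pose Q : {poly 'F_p} := \poly_(i < e) cc i.
suff Q0 : Q = 0.
  by rewrite -ccE; have := coef_poly e cc i0; rewrite -/Q Q0 coef0 ltn_ord => <-.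
have Qb : (map_poly phi Q).[beta] = 0.
  rewrite map_poly_poly horner_poly -[RHS]c0.
  by apply: eq_bigr => i _; rewrite ccE.
apply/eqP/negPn/negP => Qn0.
pose k := (size Q).-1.
have sQ : (k < e)%N.
  have := size_poly e cc; rewrite -/Q /k; have := Qn0; rewrite -size_poly_gt0.
  by case: (size Q).
pose h (v : 'rV['F_p]_k) := (map_poly phi (rVpoly v)).[beta].
have surj x : exists v, h v = x.
  suff [P Px] : exists P : {poly 'F_p}, (map_poly phi P).[beta] = x.
    exists (poly_rV (P %% Q)); rewrite /h poly_rV_K; last first.
      have := ltn_modp P Q; rewrite Qn0 /k; case: (size Q) => // n; by rewrite ltnS.
    rewrite -[RHS]Px [in RHS](divp_eq P Q) rmorphD rmorphM /= hornerD hornerM Qb.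
    by rewrite mulr0 add0r.
  have [->|x0] := eqVneq x 0; first by exists 0; rewrite rmorph0 horner0.
  have [n ->] := prim_rootP beta_prim (finField_exp_pred x0).
  by exists 'X^n; rewrite map_polyXn hornerXn.
have : (#|F| <= #|'rV['F_p]_k|)%N.
  rewrite -cardsT (_ : [set: F] = h @: setT); last first.
    by apply/setP => x; rewrite inE; have [v <-] := surj x; rewrite imset_f.
  by rewrite (leq_trans (leq_imset_card _ _)) ?cardsT.
by rewrite cF card_mx card_Fp // mul1n leq_exp2l ?prime_gt1 // leqNgt sQ.
Qed.

Lemma sum_powers_surj (y : F) :
  exists c : 'I_e -> 'F_p, \sum_i ofFp p (c i) * beta ^+ i = y.
Proof.
pose h (c : {ffun 'I_e -> 'F_p}) := \sum_i ofFp p (c i) * beta ^+ i.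
have hinj : injective h.
  move=> c c' cc; apply/ffunP => i; apply/eqP; rewrite -subr_eq0; apply/eqP.
  apply: (@sum_powers_eq0 (fun i => c i - c' i)) => {i}.
  rewrite -[RHS](subrr (h c)) [X in _ - X]cc /h -sumrB; apply: eq_bigr => i _.
  by rewrite -mulrBl -[ofFp p _]/(phi _) rmorphB.
have [|h' _ hK] := inj_card_bij hinj.
  by rewrite cF card_ffun card_Fp // card_ord.
by exists (h' y); rewrite -[RHS](hK y).
Qed.

Lemma trace_powers_eq0 (x : F) :
  (forall i : 'I_e, trace p e (beta ^+ i * x) = 0) -> x = 0.
Proof.
move=> h; apply: trace_mul_eq0 => y; have [c <-] := sum_powers_surj y.
rewrite big_distrl /= trace_sum big1 // => i _.
by rewrite -mulrA traceZ h mulr0.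
Qed.

End Powers.

End Trace.

(** * Fibres of weakly regular bent functions *)

Section Bent.

Variables (p e : nat) (F : finFieldType).
Variables (f : F -> 'F_p) (eps : int) (fstar : F -> 'F_p).
Hypotheses (p_pr : prime p) (p_odd : odd p) (e_odd : odd e).
Hypotheses (pcF : p \in [pchar F]) (cF : #|F| = (p ^ e)%N).
Hypothesis f_bent : weakly_regular_bent p e f eps fstar.

Lemma sum_eta0 : \sum_s eta0 p s = 0.
Proof.
have := sum_Fp_sqr p_pr p_odd (fun=> 1 : int).
rewrite -[LHS]addr0 => /addrI E.
by rewrite [RHS]E; apply: eq_bigr => s _; rewrite intz.
Qed.

(* Comparing the Walsh transform with the Gauss sum gives an integer relation
   between the powers of zeta, whose coefficients must all be equal. *)
Lemma bent_count (b : F) (a : 'F_p) :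
  (#|[set x : F | f x - trace p e (b * x) + a == 0]|)%:Z =
  (p ^ e.-1)%:Z
  + eps * eta0 p (-1) ^+ (e.+1)./2 * (p ^ (e.-1)./2)%:Z * eta0 p (fstar b + a).
Proof.
have [_ /(_ b) Wb] := f_bent; set n := (e.-1)./2.
have en : e = n.*2.+1 by rewrite /n; lia.
have p0 := prime_gt0 p_pr; clearbody n.
pose N s := #|[set x : F | f x - trace p e (b * x) == s]|.
(* With [e = 2 n + 1], this is [eps] times [sqrt_pstar p ^+ (2 * n)], an integer; the remaining
   factor [sqrt_pstar p] is the Gauss sum. *)
pose K : int := eps * (eta0 p (-1) * p%:Z) ^+ n.
pose t := fstar b.
have rel : \sum_s ((N s)%:Z - K * eta0 p (s - t))%:~R * zeta p ^+ nat_of_ord s = 0.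
  under eq_bigr => s _ do rewrite intrB mulrBl -[_ ^+ _]/(zchar p s).
  rewrite sumrB; apply/eqP; rewrite subr_eq0; apply/eqP.
  transitivity (walsh p e f b).
    rewrite /walsh (partition_big (fun x => f x - trace p e (b * x)) predT) //=.
    apply: eq_bigr => s _.
    rewrite (eq_bigr (fun=> zchar p s)); last by move=> x /eqP <-.
    rewrite sumr_const mulr_natl /N; congr (_ *+ _).
    by apply: eq_card => x; rewrite !inE.
  have sq : sqrt_pstar p ^+ 2 = (-1) ^+ (p.-1)./2 * p%:R.
    by rewrite -gauss_sum // gauss_sqr.
  have shift : sqrt_pstar p * zchar p t = \sum_s (eta0 p (s - t))%:~R * zchar p s.
    rewrite -gauss_sum // gauss_eta // big_distrl /= [RHS](reindex_inj (addIr t)) /=.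
    by apply: eq_bigr => s _; rewrite addrK zcharD // -mulrzl mulrA.
  have KE : K%:~R = eps%:~R * ((-1) ^+ (p.-1)./2 * p%:R) ^+ n :> algC.
    by rewrite /K intrM rmorphXn /= intrM eta0_N1 // rmorph_sign.
  rewrite Wb -[zeta p ^+ _]/(zchar p t) {1}en exprS -mul2n exprM sq.
  under [RHS]eq_bigr => s _ do rewrite intrM -mulrA.
  by rewrite -big_distrr /= -shift KE; ring.
have Ncst s : (N s)%:Z = (N 0)%:Z - K * eta0 p (0 - t) + K * eta0 p (s - t).
  have /eqP := prim_root_Fp_relation p_pr (zeta_prim p_pr) rel s.
  by rewrite subr_eq => /eqP.
set C := (N 0)%:Z - _ in Ncst.
(* The fibre sizes add up to [p ^ e], and the values of [eta0] add up to zero. *)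
have CE : C = (p ^ e.-1)%:Z.
  have : \sum_s (N s)%:Z = (p ^ e)%:Z.
    rewrite -cF -sum1_card (partition_big (fun x => f x - trace p e (b * x)) predT) //=.
    rewrite [RHS]rmorph_sum /=; apply: eq_bigr => s _.
    by rewrite sum1_card /N; congr (Posz _); apply: eq_card => x; rewrite !inE.
  rewrite (eq_bigr _ (fun s _ => Ncst s)) big_split /= -big_distrr /=.
  have -> : \sum_s eta0 p (s - t) = 0.
    by rewrite -[RHS]sum_eta0 [RHS](reindex_inj (addIr (- t))).
  rewrite mulr0 addr0.
  rewrite sumr_const -[#|_|]/#|'F_p| card_Fp // en expnS PoszM -mulr_natl natz.
  by apply: mulfI; rewrite -lt0n in p0 *; case: (p) p0.
have -> : #|[set x : F | f x - trace p e (b * x) + a == 0]| = N (- a).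
  by apply: eq_card => x; rewrite !inE addr_eq0.
(* Evaluation at [-a] brings one more factor [eta0 p (-1)], raising its exponent from [n] to
   [n + 1 = (e + 1) / 2]. *)
rewrite Ncst CE -opprD eta0N // [a + t]addrC /K; congr (_ + _).
have -> : (e.+1)./2 = n.+1 by rewrite en; lia.
by rewrite exprMn exprS -[(p ^ n)%:Z]natz natrX natz; ring.
Qed.

Lemma eps_eta0_cases :
  eps * eta0 p (-1) ^+ (e.+1)./2 = 1 \/ eps * eta0 p (-1) ^+ (e.+1)./2 = -1.
Proof.
rewrite eta0_N1 // -exprM -signr_odd.
by case: f_bent => [[->|->] _]; case: odd; [right|left|left|right].
Qed.

Hypotheses (f0 : f 0 = 0) (fN : forall x, f (- x) = f x).

(** Each nonempty fibre of squaring on [A] is a pair [x], [-x], with two elements because the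
    characteristic is odd. *)
Lemma even_card_symmetric (A : {set F}) :
  0 \notin A -> (forall x, x \in A -> - x \in A) -> ~~ odd #|A|.
Proof.
move=> A0 AN; rewrite -dvdn2 -sum1_card (partition_big (fun x => x ^+ 2) predT) //=.
apply: dvdn_sum => y _; rewrite sum1_card.
have [x /andP[xA /eqP xy]|no] := pickP [pred x | (x \in A) && (x ^+ 2 == y)]; last first.
  by rewrite eq_card0 // => x; rewrite -[LHS]no.
have x0 : x != 0 by apply: contraNneq A0 => <-.
rewrite (_ : #|_| = #|[set x; -x]|); last first.
  apply: eq_card => z; rewrite [LHS]unfold_in /= !inE -xy eqf_sqr.
  apply/andP/orP => [[_ /orP]//|].
  by case=> /eqP ->; rewrite ?eqxx ?orbT ?xA ?AN.
rewrite cards2 -addr_eq0 -mulr2n -mulr_natr mulf_eq0 (negPf x0) /=.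
have -> // : (2%:R : F) != 0.
by rewrite -(dvdn_pcharf pcF) gtnNdvd // odd_prime_gt2.
Qed.

(* f is even and vanishes at 0, so it has an odd number of zeros, whereas
   bent_count gives an even number when fstar 0 is nonzero. *)
Lemma bent_dual0 : fstar 0 = 0.
Proof.
apply: eta0_eq0; have := bent_count 0 0.
rewrite (_ : [set _ | _] = [set x | f x == 0]); last first.
  by apply/setP => x; rewrite !inE mul0r trace0 // subr0 addr0.
set A := [set x | f x == 0]; have A0 : 0 \in A by rewrite inE f0.
have : ~~ odd #|A :\ 0|.
  apply: even_card_symmetric; first by rewrite !inE eqxx.
  by move=> x; rewrite !inE oppr_eq0 fN.
have opn k : odd (p ^ k) by rewrite oddX p_odd orbT.
rewrite (cardsD1 0 A) A0 addr0.
have := opn e.-1; have := opn (e.-1)./2.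
move: (p ^ _)%N (p ^ _)%N #|_| => u v k ou ov ok.
by case: eps_eta0_cases => ->; case: (eta0_cases (fstar 0)) => ->; lia.
Qed.

End Bent.

(** * The code and its dual *)

Section Weight.

Variable K : fieldType.

Lemma wtE n (v : 'rV[K]_n) : wt v = (\sum_j (v 0 j != 0)%R)%N.
Proof.
rewrite /wt -sum1_card big_mkcond /=; apply: eq_bigr => j _.
by rewrite inE; case: (_ != _).
Qed.

Lemma wt_row_mx n1 n2 (u : 'rV[K]_n1) (v : 'rV[K]_n2) :
  wt (row_mx u v) = (wt u + wt v)%N.
Proof.
rewrite !wtE big_split_ord /=; congr (_ + _)%N; apply: eq_bigr => j _.
  by rewrite row_mxEl.
by rewrite row_mxEr.
Qed.

Lemma wt_eq0 n (v : 'rV[K]_n) : (wt v == 0%N) = (v == 0).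
Proof.
rewrite cards_eq0; apply/eqP/eqP => [v0|->]; last first.
  by apply/setP => j; rewrite !inE mxE eqxx.
apply/rowP => j; rewrite mxE; apply/eqP; have /setP/(_ j) := v0.
by rewrite !inE => /negbFE.
Qed.

Lemma row_free_systematic m n (G : 'M[K]_(m, n)) : row_free (row_mx 1%:M G).
Proof.
by apply/row_freeP; exists (col_mx 1%:M 0); rewrite mul_row_col mulmx0 addr0 mulmx1.
Qed.

Lemma dual_systematic m n (G : 'M[K]_(m, n)) (a : 'rV_m) (b : 'rV_n) :
  (row_mx a b <= dual_code (row_mx 1%:M G))%MS -> a = - (b *m G^T).
Proof.
rewrite /dual_code tr_row_mx trmx1 => /sub_kermxP.
by rewrite mul_row_col mulmx1 => /eqP; rewrite addr_eq0 => /eqP.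
Qed.

Lemma dual_systematic_mem m n (G : 'M[K]_(m, n)) (b : 'rV_n) :
  (row_mx (- (b *m G^T)) b <= dual_code (row_mx 1%:M G))%MS.
Proof.
rewrite /dual_code tr_row_mx trmx1; apply/sub_kermxP.
by rewrite mul_row_col mulmx1 addNr.
Qed.

End Weight.

Section Code.

Variables (p e : nat) (F : finFieldType).
Variables (f : F -> 'F_p) (eps : int) (fstar : F -> 'F_p).
Variables (beta : F) (d : 'I_(p ^ e) -> F).
Hypotheses (p_pr : prime p) (p_odd : odd p) (e_odd : odd e).
Hypotheses (pcF : p \in [pchar F]) (cF : #|F| = (p ^ e)%N).
Hypothesis f_bent : weakly_regular_bent p e f eps fstar.
Hypotheses (f0 : f 0 = 0) (fN : forall x, f (- x) = f x).
Hypothesis beta_prim : (#|F|.-1).-primitive_root beta.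
Hypothesis d_bij : bijective d.

Let e0 : (0 < e)%N. Proof. by case: e e_odd. Qed.
Let E := eps * eta0 p (-1) ^+ (e.+1)./2.
Let n := (e.-1)./2.
Let G := G2 p e f beta d.
Let i0 : 'I_e.+2 := ord0.
Let i1 : 'I_e.+2 := lift ord0 ord0.
Let i2 (i : 'I_e) : 'I_e.+2 := lift ord0 (lift ord0 i).

Let gam (u : 'rV['F_p]_e.+2) : F := \sum_i ofFp p (u 0 (i2 i)) * beta ^+ i.
Let ent (u : 'rV['F_p]_e.+2) (x : F) : 'F_p :=
  u 0 i1 * f x + trace p e (gam u * x) + (u 0 i0 + u 0 i1).
Let Z (u : 'rV['F_p]_e.+2) := #|[set x | ent u x == 0]|.

Lemma G2_row0 j : G i0 j = 1. Proof. by rewrite mxE. Qed.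
Lemma G2_row1 j : G i1 j = f (d j) + 1. Proof. by rewrite mxE. Qed.
Lemma G2_row2 i j : G (i2 i) j = trace p e (beta ^+ i * d j).
Proof. by rewrite mxE /= /bump /= !add1n subn2. Qed.

Lemma mul_G2 u j : (u *m G) 0 j = ent u (d j).
Proof.
rewrite mxE !big_ord_recl -/i1 G2_row0 G2_row1.
under eq_bigr => i _ do rewrite -/(i2 i) G2_row2.
rewrite /ent /gam big_distrl /= trace_sum //.
under [\sum_i trace _ _ _]eq_bigr => i _ do rewrite -mulrA traceZ //.
by rewrite -/i0; ring.
Qed.

Lemma wt_info (u : 'rV['F_p]_e.+2) :
  wt u = ((u 0 i0 != 0)%R + ((u 0 i1 != 0)%R + \sum_i (u 0 (i2 i) != 0)%R))%N.
Proof. by rewrite wtE !big_ord_recl. Qed.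

Lemma wt_codeword u : (wt (u *m G2' p e f beta d) + Z u)%N = (wt u + p ^ e)%N.
Proof.
rewrite /G2' mul_mx_row mulmx1 wt_row_mx -addnA; congr (_ + _)%N.
have -> : wt (u *m G) = #|~: [set x | ent u x == 0]|.
  rewrite wtE -sum1_card [RHS]big_mkcond (reindex d) /=; last exact: onW_bij.
  by apply: eq_bigr => j _; rewrite !inE mul_G2; case: eqP.
by rewrite addnC cardsC cF.
Qed.

(** If [gam u] is nonzero, the zeros form a fibre of the trace; otherwise the entries are a nonzero
    constant. *)
Lemma zeros_b0 (u : 'rV['F_p]_e.+2) : u != 0 -> u 0 i1 = 0 -> (Z u <= p ^ e.-1)%N.
Proof.
move=> u0 u1; rewrite /Z /ent u1.
have [g0|g0] := eqVneq (gam u) 0; last first.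
  rewrite -(card_trace_fiber p_pr pcF cF e0 (u 0 i0) g0) eq_leq //.
  by apply: eq_card => x; rewrite !inE mul0r add0r addr0.
have c0 := sum_powers_eq0 p_pr pcF cF e0 beta_prim g0.
rewrite (_ : [set _ | _] = set0) ?cards0 //; apply/setP => x.
rewrite !inE mul0r add0r addr0 g0 mul0r trace0 // add0r.
apply/negP => /eqP u00; case/negP: u0; rewrite -wt_eq0 wt_info u00 u1 !eqxx /=.
by rewrite !add0n sum_nat_eq0; apply/forallP => i; rewrite c0 eqxx.
Qed.

Lemma zeros_b1 (u : 'rV['F_p]_e.+2) : u 0 i1 != 0 ->
  (Z u)%:Z = (p ^ e.-1)%:Z + E * (p ^ n)%:Z *
    eta0 p (fstar (- (ofFp p (u 0 i1)^-1 * gam u)) + (u 0 i0 + u 0 i1) / u 0 i1).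
Proof.
move=> u1; rewrite -(bent_count p_pr p_odd e_odd pcF cF f_bent); congr (Posz _).
apply: eq_card => x; rewrite !inE.
rewrite mulNr traceN // opprK -mulrA traceZ //.
rewrite -[RHS](inj_eq (mulfI u1)) mulr0; congr (_ == _).
rewrite /ent !mulrDr [u 0 i1 * (_ / _)]mulrCA divff // mulr1.
by rewrite mulrA divff // mul1r.
Qed.

Lemma zeros_le (u : 'rV['F_p]_e.+2) : u != 0 -> (Z u <= p ^ e.-1 + p ^ n)%N.
Proof.
move=> u0; have [u1|u1] := eqVneq (u 0 i1) 0.
  by rewrite (leq_trans (zeros_b0 u0 u1)) // leq_addr.
have := zeros_b1 u1; set a := (X in _ * eta0 p X); move: (p ^ n)%N (p ^ e.-1)%N => k l.
by case: (eps_eta0_cases p_pr p_odd f_bent); rewrite -/E => ->;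
  case: (eta0_cases a) => ->; lia.
Qed.

(** The messages that attain the minimum distance: [gam] vanishes on them, so by [fstar 0 = 0] the
    number of zeros depends on [s + 1] alone. *)
Let word (s : 'F_p) : 'rV['F_p]_e.+2 :=
  \row_i (if i == i0 then s else if i == i1 then 1 else 0).

Lemma gam_word s : gam (word s) = 0.
Proof.
rewrite /gam big1 // => i _; rewrite mxE /=.
by rewrite -[ofFp _ _]/(0%:R) mul0r.
Qed.

Lemma zeros_word s : (Z (word s))%:Z = (p ^ e.-1)%:Z + E * (p ^ n)%:Z * eta0 p (s + 1).
Proof.
rewrite zeros_b1; last by rewrite mxE.
rewrite gam_word mulr0 oppr0 (bent_dual0 p_pr p_odd e_odd pcF cF f_bent) // add0r.
by rewrite !mxE /= divr1.
Qed.

Lemma wt_word s : wt (word s) = (s != 0).+1.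
Proof.
rewrite wt_info !mxE /= big1 ?addn0 ?addn1 // => i _.
by rewrite mxE.
Qed.

Lemma word_neq0 s : word s != 0.
Proof. by rewrite -wt_eq0 wt_word. Qed.

(** A weight-one message has at most [p ^ e.-1] zeros if its second entry is zero. Otherwise the
    argument of [eta0] is 1 and [E = -1] makes the correction negative. This gains the extra 1 in
    the distance. *)
Lemma zeros_wt1 (u : 'rV['F_p]_e.+2) : E = -1 -> wt u = 1%N -> (Z u < p ^ e.-1 + p ^ n)%N.
Proof.
move=> EN1 wu; have pn : (0 < p ^ n)%N by rewrite expn_gt0 prime_gt0.
have u0 : u != 0 by rewrite -wt_eq0 wu.
have [u1|u1] := eqVneq (u 0 i1) 0.
  by rewrite (leq_ltn_trans (zeros_b0 u0 u1)) // -[X in (X < _)%N]addn0 ltn_add2l.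
have [u00 c0] : u 0 i0 = 0 /\ forall i, u 0 (i2 i) = 0.
  move: wu; rewrite wt_info u1 addnCA add1n => -[] /eqP.
  rewrite addn_eq0 eqb0 negbK sum_nat_eq0 => /andP[/eqP -> /forallP c0].
  by split=> // i; have := c0 i; rewrite eqb0 negbK => /eqP.
have g0 : gam u = 0.
  by rewrite /gam big1 // => i _; rewrite c0 -[ofFp _ _]/(0%:R) mul0r.
have := zeros_b1 u1; rewrite g0 mulr0 oppr0.
rewrite (bent_dual0 p_pr p_odd e_odd pcF cF f_bent) //.
rewrite u00 !add0r divff // EN1 eta0_1; lia.
Qed.

(** Ensures that the natural-number subtractions in the minimum distance do not truncate. *)
Lemma pow_bound : (p ^ e.-1 + p ^ n < p ^ e)%N.
Proof.
have p3 := odd_prime_gt2 p_odd p_pr.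
have le : (p ^ n <= p ^ e.-1)%N by rewrite leq_exp2l ?prime_gt1 // /n; lia.
have : (0 < p ^ e.-1)%N by rewrite expn_gt0 prime_gt0.
by rewrite -[in (p ^ e)%N](prednK e0) expnS; nia.
Qed.

Lemma code_params_of_min (k : nat) (s : 'F_p) :
  (Z (word s) = p ^ e.-1 + p ^ n)%N -> wt (word s) = k ->
  (forall u : 'rV['F_p]_e.+2, u != 0 -> (k + Z u <= wt u + (p ^ e.-1 + p ^ n))%N) ->
  code_params (G2' p e f beta d) (p ^ e + e + 2) (e + 2)
          (p ^ e - p ^ e.-1 - p ^ n + k).
Proof.
move=> Zs ws low; have pb := pow_bound; split.
- by rewrite -addn2 addnC addnA.
- by rewrite (eqP (row_free_systematic _)) addn2.
split.
  exists (word s *m G2' p e f beta d); rewrite submxMl; split=> //.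
    by rewrite mulmx_free_eq0 ?word_neq0 // row_free_systematic.
  have := wt_codeword (word s); rewrite Zs ws; lia.
move=> v /submxP[u ->]; rewrite mulmx_free_eq0 ?row_free_systematic // => u0.
rewrite -(leq_add2r (Z u)) wt_codeword; have := low u u0.
by move: (Z u) (wt u) => z w; lia.
Qed.

Lemma code_params_pos : E = 1 ->
  code_params (G2' p e f beta d) (p ^ e + e + 2) (e + 2)
          (p ^ e - p ^ e.-1 - p ^ n + 1).
Proof.
move=> E1; apply: (@code_params_of_min 1 0).
- apply/eqP; rewrite -eqz_nat zeros_word E1 add0r.
  by rewrite eta0_1 mul1r mulr1.
- by rewrite wt_word eqxx.
move=> u u0; have := zeros_le u0; have : (0 < wt u)%N by rewrite lt0n wt_eq0.
lia.
Qed.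

Lemma code_params_neg : E = -1 ->
  code_params (G2' p e f beta d) (p ^ e + e + 2) (e + 2)
          (p ^ e - p ^ e.-1 - p ^ n + 2).
Proof.
move=> EN1; have [a ea] := eta0_nonsquare p_pr p_odd.
have a1 : a != 1.
  by apply/eqP => a1; move: ea; rewrite a1 eta0_1.
(* With [s + 1 = a] a nonsquare, [E * eta0 p a = 1] and the zeros are as many as possible; [a]
   differs from 1, so the message has weight 2. *)
apply: (@code_params_of_min 2 (a - 1)).
- by apply/eqP; rewrite -eqz_nat zeros_word EN1 subrK ea mulN1r mulrN1 opprK.
- by rewrite wt_word subr_eq0 a1.
move=> u u0; have := zeros_le u0; have : (0 < wt u)%N by rewrite lt0n wt_eq0.
have [/(zeros_wt1 EN1)|] := eqVneq (wt u) 1%N; lia.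
Qed.

Lemma dual_code_params :
  code_params (dual_code (G2' p e f beta d)) (p ^ e + e + 2) (p ^ e) 3.
Proof.
clear E; have nE : (e.+2 + p ^ e = p ^ e + e + 2)%N by rewrite -addn2 addnC addnA.
split=> //.
  rewrite /dual_code mxrank_ker mxrank_tr (eqP (row_free_systematic _)).
  by rewrite addnC addnK.
have [d' dK d'K] := d_bij.
split.
  (* The column of [x = 0] is [(1, 1, 0, ..., 0)], as [f 0 = 0]; cancelling it takes two systematic
     coordinates. *)
  pose j0 := d' 0; pose b : 'rV['F_p]_(p ^ e) := delta_mx 0 j0.
  exists (row_mx (- (b *m G^T)) b).
  have wb : wt b = 1%N.
    rewrite /wt (_ : [set _ | _] = [set j0]) ?cards1 //; apply/setP => j.
    by rewrite !inE mxE eqxx /=; case: (j == j0); rewrite ?oner_eq0 ?eqxx.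
  have bG i : (- (b *m G^T)) 0 i = - G i j0 by rewrite mxE -rowE !mxE.
  split; first exact: dual_systematic_mem.
    by rewrite -wt_eq0 wt_row_mx wb addn1.
  rewrite wt_row_mx wb wt_info !bG G2_row0 G2_row1 d'K f0 add0r.
  rewrite oppr_eq0 oner_eq0 big1 // => i _.
  by rewrite bG G2_row2 d'K mulr0 trace0 // oppr0 eqxx.
move=> v vC v0; rewrite -[v]hsubmxK in vC v0 *.
move: (lsubmx v) (rsubmx v) vC v0 => a b /dual_systematic ab v0.
rewrite wt_row_mx leqNgt; apply/negP => lt3.
have aE i : a 0 i = - \sum_j b 0 j * G i j.
  by rewrite ab !mxE; congr (- _); apply: eq_bigr => j _; rewrite mxE.
have b0 : b != 0.
  by apply: contraNneq v0 => b0; rewrite ab b0 mul0mx oppr0 row_mx0.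
have : (0 < wt b)%N by rewrite lt0n wt_eq0.
case wb : (wt b) lt3 => [|[|[|k]]] //= lt3 _; last by lia.
  (* One column of [G] used: the row of ones already makes [a] nonzero, so the other rows vanish at
     [j]. The trace rows force [d j = 0], where the second row is 1. *)
  have /cards1P[j jE] : #|[set j | b 0 j != 0]| == 1%N by apply/eqP.
  have bz k : k != j -> b 0 k = 0.
    by move/setP: jE => /(_ k); rewrite !inE => + /negPf kj; rewrite kj => /negbFE/eqP.
  have bj : b 0 j != 0 by move/setP: jE => /(_ j); rewrite !inE eqxx.
  have {}aE i : a 0 i = - (b 0 j * G i j).
    rewrite aE (bigD1 j) //= big1 ?addr0 // => k kj; by rewrite bz ?mul0r.
  have wa : (wt a <= 1)%N by lia.
  move: wa; rewrite wt_info aE G2_row0 mulr1 oppr_eq0 bj add1n ltnS leqn0.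
  rewrite addn_eq0 eqb0 negbK sum_nat_eq0 => /andP[a1 /forallP a2].
  have dj : d j = 0.
    apply: (trace_powers_eq0 p_pr pcF cF e0 beta_prim) => i; have := a2 i.
    by rewrite eqb0 negbK aE oppr_eq0 mulf_eq0 (negPf bj) /= G2_row2 => /eqP.
  move: a1; rewrite aE oppr_eq0 mulf_eq0 (negPf bj) G2_row1 dj f0 add0r.
  by rewrite oner_eq0.
(* Two columns used, so [a = 0]: the row of ones gives opposite coefficients, and the trace rows
   then give [d j = d k]. *)
have /cards2P[j [k [jk jkE]]] : #|[set j | b 0 j != 0]| == 2%N by apply/eqP.
have bz l : l != j -> l != k -> b 0 l = 0.
  move/setP: jkE => /(_ l); rewrite !inE => + /negPf lj /negPf lk.
  by rewrite lj lk => /negbFE/eqP.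
have bj : b 0 j != 0 by move/setP: jkE => /(_ j); rewrite !inE eqxx.
have a0 : a = 0 by apply/eqP; rewrite -wt_eq0; lia.
have {}aE i : b 0 j * G i j + b 0 k * G i k = 0.
  have := aE i; rewrite a0 mxE (bigD1 j) //= (bigD1 k) 1?eq_sym //= big1 ?addr0.
    by move/eqP; rewrite eq_sym oppr_eq0 => /eqP.
  by move=> l /andP[lj lk]; rewrite bz ?mul0r.
have bk : b 0 k = - b 0 j.
  by have := aE i0; rewrite !G2_row0 !mulr1 addrC => /eqP; rewrite addr_eq0 => /eqP.
case/negP: jk; apply/eqP; apply: (bij_inj d_bij); apply/eqP; rewrite -subr_eq0.
apply/eqP; apply: (trace_powers_eq0 p_pr pcF cF e0 beta_prim) => i.
rewrite mulrBr traceD // traceN //; apply: (mulfI bj).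
by rewrite mulr0 mulrBr -mulNr -bk -!G2_row2 aE.
Qed.

End Code.

(** Distance 5 gives balls of radius 2. The words at distance exactly 2 from the centre already
    exceed [p ^ (e + 2)] in number, since [(p - 1)^2 >= 4] and the length exceeds [p ^ e]. *)
Lemma sphere_packing_bound_d5 (p e : nat) :
  prime p -> odd p -> (3 <= e)%N ->
  sphere_packing_excludes p (p ^ e + e + 2) (p ^ e) (3 + 2).
Proof.
move=> p_pr p_odd e3; have p3 := odd_prime_gt2 p_odd p_pr.
rewrite /sphere_packing_excludes -addnA expnD ltn_pmul2l ?expn_gt0 ?prime_gt0 //.
rewrite big_ord_recr; apply: leq_trans (leq_addl _ _).
rewrite [nat_of_ord _](_ : _ = 2%N) // bin2.
have q1 : (0 < p ^ e)%N by rewrite expn_gt0 prime_gt0.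
have c4 : (4 <= (p - 1) ^ 2)%N by rewrite (leq_exp2r 2 (p - 1) (e := 2)) //; lia.
have rq : (p ^ (e + 2) <= p ^ e * p ^ e)%N by rewrite -expnD leq_exp2l ?prime_gt1 //; lia.
set N := (p ^ e + (e + 2))%N.
have xq : (p ^ e * p ^ e + p ^ e <= N * N.-1)%N.
  by rewrite /N; case: (p ^ e)%N q1 => // q _; rewrite addSn /=; nia.
apply: leq_trans (leq_mul (leqnn _) c4).
move: (N * N.-1)%N (p ^ e * p ^ e)%N (p ^ (e + 2))%N (p ^ e)%N xq rq q1 => x y r q; lia.
Qed.

Theorem theorem4p5 (p e : nat) (F : finFieldType)
  (f : F -> 'F_p) (eps : int) (fstar : F -> 'F_p)
  (beta : F) (d : 'I_(p ^ e) -> F) :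
  prime p -> odd p -> (3 <= e)%N -> odd e ->
  p \in [pchar F] -> #|F| = (p ^ e)%N ->
  in_RF p e f ->
  weakly_regular_bent p e f eps fstar ->
  (#|F|.-1).-primitive_root beta ->
  bijective d ->
  (forall j : 'I_(p ^ e), (j : nat) = (p ^ e).-1 -> d j = 0) ->
  [/\ eps * eta0 p (-1) ^+ (e.+1)./2 = 1 ->
        code_params (G2' p e f beta d) (p ^ e + e + 2) (e + 2)
          (p ^ e - p ^ e.-1 - p ^ (e.-1)./2 + 1),
      eps * eta0 p (-1) ^+ (e.+1)./2 = -1 ->
        code_params (G2' p e f beta d) (p ^ e + e + 2) (e + 2)
          (p ^ e - p ^ e.-1 - p ^ (e.-1)./2 + 2),
      code_params (dual_code (G2' p e f beta d)) (p ^ e + e + 2) (p ^ e) 3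
    & sphere_packing_excludes p (p ^ e + e + 2) (p ^ e) (3 + 2)].
Proof.
move=> p_pr p_odd e3 e_odd pcF cF [_ [f0 [h [_ h_even _ fh]]]] f_bent beta_prim d_bij _.
(* Homogeneity at [a = -1] with [h] even; this evenness feeds the parity argument for
   [fstar 0 = 0]. *)
have fN x : f (- x) = f x.
  have N1 : ofFp p (-1) = -1 :> F.
    by have := ofFp_is_zmod_morphism p_pr pcF 0 1; rewrite !sub0r.
  have := fh (-1) x; rewrite N1 mulN1r oppr_eq0 oner_eq0 => -> //.
  by rewrite -signr_odd (negPf h_even) mul1r.
split.
- exact: (code_params_pos p_pr p_odd e_odd pcF cF f_bent f0 fN beta_prim d_bij).
- exact: (code_params_neg p_pr p_odd e_odd pcF cF f_bent f0 fN beta_prim d_bij).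
- exact: (dual_code_params p_pr p_odd e_odd pcF cF f0 beta_prim d_bij).
- exact: sphere_packing_bound_d5.
Qed.
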